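(* A diffeomorphism of $S^{1|1}$ $$\phi\mapsto Q(\phi;\mathfrak a)+q(\phi;\mathfrak a)\theta,\qquad\theta\mapsto R(\phi;\mathfrak a)\theta+r(\phi;\mathfrak a)$$ is contact if and only if $$R^2=\partial_\phi Q+r\cdot\partial_\phi r,\qquad q+rR=0.$$
   Context: $\mathcal A$ is the complex Grassmann algebra with countably many generators $\mathfrak a_1,\mathfrak a_2,\dots$, $\mathfrak a_k\mathfrak a_l=-\mathfrak a_l\mathfrak a_k$, $\mathfrak a_k^2=0$ (finite linear combinations of monomials), $\mathcal A_{\bar0},\mathcal A_{\bar1}$ its even and odd parts; the subscript $\downarrow$ means putting all $\mathfrak a_j=0$. $S^{1|1}$ is the circle $\phi\in\mathbb R/2\pi\mathbb Z$ with an additional odd coordinate $\theta$, $\theta^2=0$; $\theta$ is assumed to commute with all $\mathfrak a_j$. A diffeomorphism of $S^{1|1}$ is a change of variables as in the claim, where $Q,R$ are $\mathcal A_{\bar0}$-valued and $q,r$ are $\mathcal A_{\bar1}$-valued smooth functions of $\phi$, $Q_\downarrow,R_\downarrow$ take real values, and $\partial_\phi Q_\downarrow\ne0$, $R_\downarrow\ne0$ for all $\phi$. The standard contact form is $\Omega=d\phi+\theta\,d\theta$. A change of variables is applied to forms by $d\phi\mapsto(\partial_\phi Q+\partial_\phi q\cdot\theta)\,d\phi+q\,d\theta$, $d\theta\mapsto(\partial_\phi R\cdot\theta+\partial_\phi r)\,d\phi+R\,d\theta$. A diffeomorphism is contact if it sends $\Omega$ to an expression of the form $h(\phi,\theta;\mathfrak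 a)\cdot\Omega$. *)

(* Defs.v *)
From HB Require Import structures.
From mathcomp Require Import all_boot all_order all_algebra finmap.
From mathcomp Require Import complex monalg.
From mathcomp Require Import all_classical all_reals all_analysis.

Set Implicit Arguments.
Unset Strict Implicit.
Unset Printing Implicit Defensive.

Import Order.TTheory GRing.Theory Num.Theory.
Import numFieldNormedType.Exports.

Local Open Scope ring_scope.

(* The Grassmann algebra over C on generators indexed by nat: finite linear
   combinations of the monomials a_S = a_(i1) ... a_(ik), for finite sets
   S = {i1 < ... < ik}. *)
Definition grassmann (C : comNzRingType) := {malg C[{fset nat}]}.

HB.instance Definition _ (C : comNzRingType) :=
  GRing.Zmodule.copy (grassmann C) {malg C[{fset nat}]}.

(* the scaling of malg, locked to keep conversion from unfolding it *)
HB.lock Definition gscale (C : comNzRingType) (a : C) (x : grassmann C) :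
  grassmann C := (a *: (x : {malg C[{fset nat}]})).

Section GrassmannLmodule.
Variable C : comNzRingType.
Local Notation A := (grassmann C).

Lemma gscaleA (a b : C) (x : A) : gscale a (gscale b x) = gscale (a * b) x.
Proof. by rewrite gscale.unlock; exact: scalerA. Qed.

Lemma gscale1 : left_id 1 (@gscale C).
Proof. by move=> x; rewrite gscale.unlock; exact: scale1r. Qed.

Lemma gscaleDr : right_distributive (@gscale C) +%R.
Proof. by move=> a x y; rewrite gscale.unlock; exact: scalerDr. Qed.

Lemma gscaleDl (x : A) : {morph (@gscale C)^~ x : a b / a + b}.
Proof. by move=> a b; rewrite gscale.unlock; exact: scalerDl. Qed.

HB.instance Definition _ := GRing.Zmodule_isLmodule.Build C A
  gscaleA gscale1 gscaleDr gscaleDl.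

End GrassmannLmodule.

Definition gcoef (C : comNzRingType) (S : {fset nat}) (x : grassmann C) : C :=
  mcoeff S x.

HB.lock Definition gmon (C : comNzRingType) (S : {fset nat}) : grassmann C :=
  mkmalgU S 1.
Arguments gmon {C} S.

(* the number of transpositions needed to sort the concatenation of the
   increasing enumerations of S and T *)
Definition crossings (S T : {fset nat}) : nat :=
  (\sum_(i <- S) \sum_(j <- T) (j < i))%N.

Definition gmul_mon (C : comNzRingType) (S T : {fset nat}) : grassmann C :=
  if [disjoint S & T]%fset then (-1) ^+ crossings S T *: gmon (S `|` T)%fset
  else 0.
Arguments gmul_mon {C} S T.

HB.lock Definition gmul (C : comNzRingType) (x y : grassmann C) : grassmann C :=
  \sum_(S <- msupp x) \sum_(T <- msupp y)
    (gcoef S x * gcoef T y) *: gmul_mon S T.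

Section GrassmannRing.
Variable C : comNzRingType.
Local Notation A := (grassmann C).
Local Notation gmul := (@gmul C).
Local Notation gmon := (@gmon C).
Local Notation gmul_mon := (@gmul_mon C).
Implicit Types (S T U : {fset nat}) (x y z : A).

Lemma gcoefP x y : (forall S, gcoef S x = gcoef S y) <-> x = y.
Proof. exact: (malgP x y). Qed.

Lemma gcoef_is_linear S : scalar (@gcoef C S).
Proof. move=> a x y; rewrite /gcoef mcoeffD; congr (_ + _).
by rewrite {1}/GRing.scale /= gscale.unlock; exact: mcoeffZ. Qed.
HB.instance Definition _ S :=
  GRing.isLinear.Build C A C _ (@gcoef C S) (gcoef_is_linear S).

Lemma gcoef_mon S T : gcoef T (gmon S) = (S == T)%:R :> C.
Proof. by rewrite gmon.unlock /gcoef mcoeffU. Qed.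

Lemma gcoef_out S x : S \notin msupp x -> gcoef S x = 0.
Proof. exact: mcoeff_outdom. Qed.

Lemma grassmannE x : x = \sum_(S <- msupp x) gcoef S x *: gmon S.
Proof.
apply/gcoefP => T; rewrite raddf_sum /=.
under eq_bigr do rewrite linearZ /= gcoef_mon.
have [Tx|Tx] := boolP (T \in msupp x).
  rewrite (bigD1_seq T) ?fset_uniq //= eqxx mulr1 big1 ?addr0 // => S /negPf ->.
  by rewrite mulr0.
rewrite gcoef_out // big_seq big1 // => S Sx.
by case: eqP => [E|_]; [rewrite -E Sx in Tx | rewrite mulr0].
Qed.

Lemma gmulEw (D1 D2 : {fset {fset nat}}) x y :
  (msupp x `<=` D1)%fset -> (msupp y `<=` D2)%fset ->
  gmul x y =
  \sum_(S <- D1) \sum_(T <- D2) (gcoef S x * gcoef T y) *: gmul_mon S T.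
Proof.
move=> /fsubsetP le1 /fsubsetP le2; rewrite gmul.unlock.
rewrite (big_fset_incl _ (A := msupp x) (B := D1)) //=; last 2 first.
- exact/fsubsetP.
- move=> S _ Sx; rewrite big1 // => T _.
  by rewrite gcoef_out // mul0r scale0r.
apply: eq_bigr => S _; rewrite (big_fset_incl _ (A := msupp y) (B := D2)) //=.
- exact/fsubsetP.
- by move=> T _ Ty; rewrite [gcoef T y]gcoef_out // mulr0 scale0r.
Qed.

Lemma gmul_linearr x : linear (gmul x).
Proof.
move=> a y z.
pose D := (msupp y `|` msupp z `|` msupp (a *: y + z : A))%fset.
have sub u : (msupp u `<=` D)%fset -> gmul x u =
  \sum_(S <- msupp x) \sum_(T <- D) (gcoef S x * gcoef T u) *: gmul_mon S T.
  by move=> h; exact: gmulEw.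
rewrite !sub; first 1 last.
- by rewrite /D -fsetUA fsetUCA fsubsetUl.
- by rewrite /D -fsetUA fsubsetUl.
- by rewrite /D fsubsetUr.
rewrite scaler_sumr -big_split; apply: eq_bigr => S _ /=.
rewrite scaler_sumr -big_split; apply: eq_bigr => T _ /=.
by rewrite linearP /= mulrDr scalerDl scalerA mulrCA.
Qed.

Lemma gmul_linearl y : linear (gmul^~ y).
Proof.
move=> a x z.
pose D := (msupp x `|` msupp z `|` msupp (a *: x + z : A))%fset.
have sub u : (msupp u `<=` D)%fset -> gmul u y =
  \sum_(S <- D) \sum_(T <- msupp y) (gcoef S u * gcoef T y) *: gmul_mon S T.
  by move=> h; exact: gmulEw.
rewrite !sub; first 1 last.
- by rewrite /D -fsetUA fsetUCA fsubsetUl.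
- by rewrite /D -fsetUA fsubsetUl.
- by rewrite /D fsubsetUr.
rewrite scaler_sumr -big_split; apply: eq_bigr => S _ /=.
rewrite scaler_sumr -big_split; apply: eq_bigr => T _ /=.
by rewrite linearP /= mulrDl scalerDl scalerA mulrA.
Qed.

Let mulr_lin x : {linear A -> A} :=
  HB.pack (gmul x) (GRing.isLinear.Build C A A _ (gmul x) (gmul_linearr x)).
Let mull_lin y : {linear A -> A} :=
  HB.pack (gmul^~ y)
    (GRing.isLinear.Build C A A _ (gmul^~ y) (gmul_linearl y)).

Lemma gmul_sumr x I (r : seq I) (P : pred I) (F : I -> A) :
  gmul x (\sum_(i <- r | P i) F i) = \sum_(i <- r | P i) gmul x (F i).
Proof. exact: (raddf_sum (mulr_lin x)). Qed.

Lemma gmul_suml y I (r : seq I) (P : pred I) (F : I -> A) :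
  gmul (\sum_(i <- r | P i) F i) y = \sum_(i <- r | P i) gmul (F i) y.
Proof. exact: (raddf_sum (mull_lin y)). Qed.

Lemma gmulZr a x y : gmul x (a *: y) = a *: gmul x y.
Proof. exact: (linearZ_LR (mulr_lin x)). Qed.

Lemma gmulZl a x y : gmul (a *: x) y = a *: gmul x y.
Proof. exact: (linearZ_LR (mull_lin y)). Qed.

Lemma gmul0r x : gmul x 0 = 0. Proof. exact: (raddf0 (mulr_lin x)). Qed.
Lemma gmul0l x : gmul 0 x = 0. Proof. exact: (raddf0 (mull_lin x)). Qed.

Lemma gmul_monE S T : gmul (gmon S) (gmon T) = gmul_mon S T.
Proof.
have sub U : (msupp (gmon U : A) `<=` [fset U])%fset.
  by rewrite gmon.unlock; exact: msuppU_le.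
rewrite (gmulEw (sub S) (sub T)) !big_seq_fset1 !gcoef_mon !eqxx.
by rewrite mulr1 scale1r.
Qed.

Lemma big_fsetU_addn S T (F : nat -> nat) : [disjoint S & T]%fset ->
  (\sum_(i <- (S `|` T)%fset) F i = \sum_(i <- S) F i + \sum_(i <- T) F i)%N.
Proof.
move=> dST; rewrite -big_cat /=; apply: perm_big; apply: uniq_perm.
- exact: fset_uniq.
- rewrite cat_uniq !fset_uniq andbT /=; apply/hasPn => i iT.
  by apply: contraL iT => iS; exact: (fdisjointP dST).
- by move=> i; rewrite mem_cat inE.
Qed.

Lemma gmul_monA S T U :
  gmul (gmon S) (gmul_mon T U) = gmul (gmul_mon S T) (gmon U).
Proof.
rewrite {1}/gmul_mon [in RHS]/gmul_mon.
have crUl : [disjoint S & T]%fset ->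
    crossings (S `|` T)%fset U = (crossings S U + crossings T U)%N.
  by move=> dST; rewrite /crossings big_fsetU_addn.
have crUr : [disjoint T & U]%fset ->
    crossings S (T `|` U)%fset = (crossings S T + crossings S U)%N.
  move=> dTU; rewrite /crossings -big_split; apply: eq_bigr => i _ /=.
  by rewrite big_fsetU_addn.
have [dTU|/negPf dTU] := boolP [disjoint T & U]%fset;
  have [dST|/negPf dST] := boolP [disjoint S & T]%fset.
- rewrite gmulZr gmulZl !gmul_monE /gmul_mon.
  rewrite fdisjointXU fdisjointUX dST dTU /= andbT.
  have [dSU|_] := boolP [disjoint S & U]%fset; last by rewrite !scaler0.
  rewrite (crUl dST) (crUr dTU) !scalerA -!exprD fsetUA.
  congr (_ ^+ _ *: _).
  by rewrite addnC -!addnA; congr (_ + _)%N.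
- by rewrite gmul0l gmulZr gmul_monE /gmul_mon fdisjointXU dST scaler0.
- by rewrite gmul0r gmulZl gmul_monE /gmul_mon fdisjointUX dTU andbF scaler0.
- by rewrite gmul0l gmul0r.
Qed.

Lemma gmulA : associative gmul.
Proof.
move=> x y z; rewrite [x]grassmannE !gmul_suml; apply: eq_bigr => S _.
rewrite !gmulZl; congr (_ *: _).
rewrite [y]grassmannE !(gmul_suml, gmul_sumr); apply: eq_bigr => T _.
rewrite !(gmulZl, gmulZr); congr (_ *: _).
rewrite [z]grassmannE !gmul_sumr; apply: eq_bigr => U _.
by rewrite !gmulZr !gmul_monE gmul_monA.
Qed.

Lemma gmul1l : left_id (gmon fset0) gmul.
Proof.
move=> x; rewrite {1}[x]grassmannE gmul_sumr [RHS]grassmannE.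
apply: eq_bigr => S _; rewrite gmulZr gmul_monE /gmul_mon fdisjoint0X.
by rewrite /crossings big_seq_fset0 expr0 scale1r fset0U.
Qed.

Lemma gmul1r : right_id (gmon fset0) gmul.
Proof.
move=> x; rewrite {1}[x]grassmannE gmul_suml [RHS]grassmannE.
apply: eq_bigr => S _; rewrite gmulZl gmul_monE /gmul_mon fdisjointX0.
rewrite /crossings big1 => [|i _]; last by rewrite big_seq_fset0.
by rewrite expr0 scale1r fsetU0.
Qed.

Lemma gmulDl : left_distributive gmul +%R.
Proof. by move=> x y z; exact: (raddfD (mull_lin z)). Qed.

Lemma gmulDr : right_distributive gmul +%R.
Proof. by move=> x y z; exact: (raddfD (mulr_lin x)). Qed.

Lemma gone_neq0 : gmon fset0 != 0.
Proof.
apply/eqP => /gcoefP/(_ fset0)/eqP.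
by rewrite gcoef_mon eqxx linear0 oner_eq0.
Qed.

HB.instance Definition _ := GRing.Zmodule_isNzRing.Build A
  gmulA gmul1l gmul1r gmulDl gmulDr gone_neq0.

Lemma gscaleAl (a : C) x y : a *: (x * y) = (a *: x) * y.
Proof. by rewrite [RHS]gmulZl. Qed.
HB.instance Definition _ := GRing.Lmodule_isLalgebra.Build C A gscaleAl.

Lemma gscaleAr (a : C) x y : a *: (x * y) = x * (a *: y).
Proof. by rewrite [RHS]gmulZr. Qed.
HB.instance Definition _ := GRing.Lalgebra_isAlgebra.Build C A gscaleAr.

Definition ggen (k : nat) : A := gmon [fset k]%fset.

Lemma ggen_anticomm k l : ggen k * ggen l = - (ggen l * ggen k).
Proof.
have -> : ggen k * ggen l = gmul_mon [fset k]%fset [fset l]%fset.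
  exact: gmul_monE.
have -> : ggen l * ggen k = gmul_mon [fset l]%fset [fset k]%fset.
  exact: gmul_monE.
rewrite /gmul_mon fdisjointX1 fdisjointX1 !inE eq_sym.
have [->|ne] := eqVneq l k; first by rewrite oppr0.
rewrite /crossings !big_seq_fset1 fsetUC -scaleNr; congr (_ *: _).
by case: ltngtP ne => //= _ _; rewrite ?expr1 ?expr0 ?opprK.
Qed.

Lemma ggen_sqr k : ggen k ^+ 2 = 0.
Proof.
rewrite expr2.
have -> : ggen k * ggen k = gmul_mon [fset k]%fset [fset k]%fset.
  exact: gmul_monE.
by rewrite /gmul_mon fdisjointX1 inE eqxx.
Qed.

(* a_S is the product of its generators in increasing order *)
Lemma gmon_cons k S : {in S, forall i, (k < i)%N} ->
  gmon (k |` S)%fset = ggen k * gmon S.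
Proof.
move=> kS; have -> : ggen k * gmon S = gmul_mon [fset k]%fset S.
  exact: gmul_monE.
rewrite /gmul_mon fdisjoint1X; case: ifP => [_|/negbFE/kS]; last first.
  by rewrite ltnn.
rewrite /crossings big_seq_fset1 big_seq big1 ?expr0 ?scale1r // => j /kS.
by rewrite ltnNge => /negPf; rewrite leq_eqVlt => /norP[_ /negPf ->].
Qed.

Definition geven : pred A := fun x => all (fun S => ~~ odd #|` S|) (msupp x).
Definition godd : pred A := fun x => all (fun S => odd #|` S|) (msupp x).

(* the value at a_1 = a_2 = ... = 0 *)
Definition gbody x : C := gcoef fset0 x.

End GrassmannRing.

(* B[theta] / (theta ^ 2) with theta commuting with B; (b0, b1) stands for
   b0 + b1 * theta *)
Definition with_theta (B : nzRingType) : Type := (B * B)%type.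

Section WithTheta.
Variable B : nzRingType.
Local Notation Bt := (with_theta B).
Implicit Types x y z : Bt.

HB.instance Definition _ := GRing.Zmodule.copy Bt (B * B)%type.

Definition tmul x y : Bt := (x.1 * y.1, x.1 * y.2 + x.2 * y.1).
Definition tone : Bt := (1, 0).

Lemma tmulA : associative tmul.
Proof.
move=> x y z; rewrite /tmul /= !mulrDl !mulrDr !mulrA.
by congr (_, _); rewrite addrA.
Qed.

Lemma tmul1l : left_id tone tmul.
Proof. by case=> a b; rewrite /tmul /= !mul1r mul0r addr0. Qed.

Lemma tmul1r : right_id tone tmul.
Proof. by case=> a b; rewrite /tmul /= !mulr1 mulr0 add0r. Qed.

Lemma tmulDl : left_distributive tmul +%R.
Proof. by move=> x y z; rewrite /tmul /= !mulrDl addrACA. Qed.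

Lemma tmulDr : right_distributive tmul +%R.
Proof. by move=> x y z; rewrite /tmul /= !mulrDr addrACA. Qed.

Lemma tone_neq0 : tone != 0.
Proof. by apply/eqP => -[] /eqP; rewrite oner_eq0. Qed.

HB.instance Definition _ := GRing.Zmodule_isNzRing.Build Bt
  tmulA tmul1l tmul1r tmulDl tmulDr tone_neq0.

Definition theta : Bt := (0, 1).
Definition tconst (b : B) : Bt := (b, 0).

Lemma theta_sqr : theta ^+ 2 = 0.
Proof. by congr (_, _); rewrite /= ?mul0r ?mulr0 ?addr0. Qed.

Lemma theta_comm b : theta * tconst b = tconst b * theta.
Proof. by congr (_, _); rewrite /= !(mul0r, mulr0, mul1r, mulr1, addr0, add0r). Qed.

Lemma with_thetaE x : x = tconst x.1 + tconst x.2 * theta.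
Proof.
case: x => a b; congr (_, _).
  by rewrite /= mulr0 addr0.
by rewrite /= mulr1 mul0r addr0 add0r.
Qed.

End WithTheta.
Arguments theta {B}.

Notation "b %:G" := (tconst b) (at level 1, format "b %:G")
  : ring_scope.

(* 1-forms at a point of the circle: the free left module over B[theta] with
   basis d phi, d theta *)
Definition form1 (B : nzRingType) : lmodType (with_theta B) :=
  ((with_theta B)^o * (with_theta B)^o)%type.
Definition dphi {B : nzRingType} : form1 B := (1, 0).
Definition dtheta {B : nzRingType} : form1 B := (0, 1).

Section Calculus.
Local Open Scope complex_scope.
Local Open Scope classical_set_scope.
Variable K : realType.
Local Notation A := (grassmann K[i]).

Definition smooth (f : K -> K) := forall n x, derivable (f^`(n)) x 1.

Definition csmooth (f : K -> K[i]) :=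
  smooth (fun x => complex.Re (f x)) /\ smooth (fun x => complex.Im (f x)).

Definition cderive (f : K -> K[i]) (x : K) : K[i] :=
  (fun y => complex.Re (f y))^`() x +i* (fun y => complex.Im (f y))^`() x.

(* f is a finite sum of smooth functions times fixed monomials.  On the circle,
   by compactness, this is smoothness with respect to the inductive limit
   topology of the finite-dimensional subspaces of A. *)
Definition gsmooth (f : K -> A) :=
  (exists D : {fset {fset nat}}, forall x, (msupp (f x) `<=` D)%fset) /\
  (forall S, csmooth (fun x => gcoef S (f x))).

(* the coefficientwise derivative; the default value 0 is never used when
   f is smooth, see gcoef_gderive *)
Definition gderive (f : K -> A) (x : K) : A :=
  xget 0 [set a : A | forall S, gcoef S a = cderive (fun y => gcoef S (f y)) x].

Lemma gcoef_gderive (f : K -> A) S x : gsmooth f ->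
  gcoef S (gderive f x) = cderive (fun y => gcoef S (f y)) x.
Proof.
case=> -[D fD] _; rewrite /gderive; case: xgetP => [a _ -> //|/= no].
exfalso; pose c T := cderive (fun y => gcoef T (f y)) x.
apply: (no (\sum_(T <- D) c T *: gmon T)) => T.
rewrite raddf_sum /=; under eq_bigr do rewrite linearZ /= gcoef_mon.
have [TD|TD] := boolP (T \in D).
  rewrite (bigD1_seq T) ?fset_uniq //= eqxx mulr1 big1 ?addr0 // => U /negPf ->.
  by rewrite mulr0.
rewrite big_seq big1 => [|U UD]; last first.
  by case: eqP => [E|_]; [rewrite -E UD in TD | rewrite mulr0].
have f0 y : gcoef T (f y) = 0.
  by apply: gcoef_out; apply: contra TD; exact/fsubsetP.
rewrite /cderive; under eq_fun do rewrite f0.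
by under [X in _ = _ +i* X^`() _]eq_fun do rewrite f0; rewrite !derive1_cst.
Qed.

(* Functions on the circle R / 2 pi Z are 2 pi-periodic functions on the
   line. *)
Definition circle_smooth (f : K -> A) := gsmooth f /\ periodic f (2 * pi).

Definition superfunction (h : K -> with_theta A) :=
  circle_smooth (fun x => (h x).1) /\ circle_smooth (fun x => (h x).2).

(* Since Q is a coordinate on the target circle, it is given by a lift, which is
   periodic up to +- 2 pi (according to the orientation). *)
Record superdiffeo (Q q R r : K -> A) : Prop := SuperDiffeo {
  diffeo_smoothQ : gsmooth Q;
  diffeo_liftQ : exists s : bool,
    forall x, Q (x + 2 * pi) = Q x + ((-1) ^+ s * (2 * pi)%:C)%:A;
  diffeo_smoothR : circle_smooth R;
  diffeo_smoothq : circle_smooth q;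
  diffeo_smoothr : circle_smooth r;
  diffeo_evenQ : forall x, geven (Q x);
  diffeo_evenR : forall x, geven (R x);
  diffeo_oddq : forall x, godd (q x);
  diffeo_oddr : forall x, godd (r x);
  diffeo_realQ : forall x, gbody (Q x) \is Num.real;
  diffeo_realR : forall x, gbody (R x) \is Num.real;
  diffeo_dQ : forall x, cderive (fun y => gbody (Q y)) x != 0;
  diffeo_R : forall x, gbody (R x) != 0
}.

Definition contact_form : form1 A := dphi + theta *: dtheta.

Section Pullback.
Variables Q q R r : K -> A.

Definition pull_theta (x : K) : with_theta A := (R x)%:G * theta + (r x)%:G.

Definition pull_dphi (x : K) : form1 A :=
  ((gderive Q x)%:G + (gderive q x)%:G * theta) *: dphi + (q x)%:G *: dtheta.

Definition pull_dtheta (x : K) : form1 A :=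
  ((gderive R x)%:G * theta + (gderive r x)%:G) *: dphi + (R x)%:G *: dtheta.

(* the change of variables in an expression b0 + b1 * theta not involving phi *)
Definition pull_coef (b : with_theta A) (x : K) : with_theta A :=
  b.1%:G + b.2%:G * pull_theta x.

Definition pull_form (w : form1 A) (x : K) : form1 A :=
  pull_coef w.1 x *: pull_dphi x + pull_coef w.2 x *: pull_dtheta x.

Definition contact : Prop :=
  exists h : K -> with_theta A, superfunction h /\
    forall x, pull_form contact_form x = h x *: contact_form.

End Pullback.

End Calculus.

(* Main.v *)
(* The change of variables sends Omega to
   (Q' + r r' + (q' + r R' + R r') theta) dphi + (q + r R + R^2 theta) dtheta,
   while h Omega = h dphi + h0 theta dtheta for h = h0 + h1 theta.  The dphi
   component determines h, so a contact factor exists iff q + r R = 0 and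
   R^2 = h0 = Q' + r r'.  Taking h0 = R^2 shows that h is periodic although Q
   itself is not. *)
Require Import Defs.
From mathcomp Require Import all_boot all_order all_algebra finmap.
From mathcomp Require Import complex monalg.
From mathcomp Require Import all_classical all_reals all_analysis.
Import Order.TTheory GRing.Theory Num.Theory.
Local Open Scope ring_scope.
Local Open Scope complex_scope.

(** * Smooth real functions: constants, sums, products, derivatives *)

Section Smooth.
Local Open Scope classical_set_scope.
Variable K : realType.
Implicit Types f g : K -> K.

Lemma smooth_cst (c : K) : smooth (fun=> c).
Proof.
have d_cst b : (fun=> b : K)^`() = (fun=> 0) :> (K -> K).
  by apply/funext => x; exact: derive1_cst.
have dn n : exists b : K, (fun=> c)^`(n) = (fun=> b) :> (K -> K).
  elim: n => [|n [b IH]]; first by exists c.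
  by exists 0; rewrite derive1nS IH d_cst.
by move=> n x; have [b ->] := dn n; exact: derivable_cst.
Qed.

Lemma smooth_derive1 f : smooth f -> smooth f^`().
Proof. by move=> fS n x; rewrite -derive1Sn. Qed.

(** Smoothness cut off at a finite order. The product rule expresses the derivative of a product
    through products with one order less to spare, so closure under products needs an order to
    induct on. *)
Let smooth_upto m f :=
  forall n, (n <= m)%N -> forall x, derivable (f^`(n)) x 1.

Let smooth_uptoW m f : smooth_upto m.+1 f -> smooth_upto m f.
Proof. by move=> fS n nm; apply: fS; exact: leqW. Qed.

Let smooth_uptoS m f : (forall x, derivable f x 1) ->
  smooth_upto m f^`() -> smooth_upto m.+1 f.
Proof. by move=> df dfS [|n] nm x //; rewrite derive1Sn; exact: dfS. Qed.

Let smooth_uptoD m f g :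
  smooth_upto m f -> smooth_upto m g -> smooth_upto m (fun x => f x + g x).
Proof.
move=> fS gS n nm.
(* The bound on [k] matters: passing from order [k] to [k.+1] uses derivability of both order-[k]
   derivatives. *)
have E k : (k <= m)%N ->
    (fun x => f x + g x)^`(k) = (f^`(k) \+ g^`(k)).
  elim: k => [|k IH] km; first by [].
  rewrite !derive1nS IH ?(ltnW km) //; apply/funext => x.
  have kf := fS k (ltnW km) x; have kg := gS k (ltnW km) x.
  by rewrite /= !derive1E; exact: (deriveD kf kg).
by move=> x; rewrite E //; exact: (derivableD (fS n nm x) (gS n nm x)).
Qed.

(** Induction on [m] for all pairs at once: the derivative of f g is f g' + g f', and the hypothesis
    at [m] covers the pairs (f, g') and (g, f'). This avoids the general Leibniz formula. *)
Let smooth_uptoM m f g :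
  smooth_upto m f -> smooth_upto m g -> smooth_upto m (fun x => f x * g x).
Proof.
elim: m f g => [|m IH] f g fS gS.
  move=> [|//] _ x; exact: (derivableM (fS 0%N isT x) (gS 0%N isT x)).
have df x : derivable f x 1 by exact: (fS 0%N).
have dg x : derivable g x 1 by exact: (gS 0%N).
apply: smooth_uptoS => [x|]; first exact: (derivableM (df x) (dg x)).
have -> : (fun x => f x * g x)^`() =
    (fun x => f x * derive1 g x + g x * derive1 f x).
  by apply/funext => x; rewrite !derive1E; exact: (deriveM (df x) (dg x)).
by apply: smooth_uptoD; apply: IH; try exact: smooth_uptoW;
  move=> n nm x; rewrite -derive1Sn; [exact: gS | exact: fS].
Qed.

Lemma smoothD f g : smooth f -> smooth g -> smooth (fun x => f x + g x).
Proof.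
by move=> fS gS n; exact: (@smooth_uptoD n).
Qed.

Lemma smoothM f g : smooth f -> smooth g -> smooth (fun x => f x * g x).
Proof.
by move=> fS gS n; exact: (@smooth_uptoM n).
Qed.

Lemma periodic_derive1 f T : periodic f T -> periodic f^`() T.
Proof.
by move=> fT x; rewrite /derive1; under eq_fun do rewrite addrA !fT.
Qed.

End Smooth.

(** * Smooth complex-valued functions, by real and imaginary parts *)

Section ComplexSmooth.
Variable K : realType.
Implicit Types f g : K -> K[i].

Lemma csmooth_cst (c : K[i]) : csmooth (fun=> c).
Proof. by split; exact: smooth_cst. Qed.

Lemma csmoothD f g : csmooth f -> csmooth g -> csmooth (fun x => f x + g x).
Proof.
move=> [fr fi] [gr gi]; split.
  by under eq_fun do rewrite raddfD; exact: smoothD.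
by under eq_fun do rewrite raddfD; exact: smoothD.
Qed.

Lemma csmoothM f g : csmooth f -> csmooth g -> csmooth (fun x => f x * g x).
Proof.
move=> [fr fi] [gr gi].
(* The difference is written with the constant factor -1, so that closure under sums and products
   suffices. *)
have ReM (a b : K[i]) : complex.Re (a * b) =
    complex.Re a * complex.Re b + (-1) * (complex.Im a * complex.Im b).
  by case: a b => [a1 a2] [b1 b2]; rewrite mulN1r.
have ImM (a b : K[i]) : complex.Im (a * b) =
    complex.Re a * complex.Im b + complex.Im a * complex.Re b.
  by case: a b => [a1 a2] [b1 b2].
split; [under eq_fun do rewrite ReM | under eq_fun do rewrite ImM].
  by apply: smoothD; apply: smoothM => //; [exact: smooth_cst | exact: smoothM].
by apply: smoothD; exact: smoothM.
Qed.

Lemma csmooth_sum (I : Type) (s : seq I) (F : I -> K -> K[i]) :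
  (forall i, csmooth (F i)) -> csmooth (fun x => \sum_(i <- s) F i x).
Proof.
move=> FS; elim: s => [|i s IH].
  by under eq_fun do rewrite big_nil; exact: csmooth_cst.
by under eq_fun do rewrite big_cons; exact: csmoothD.
Qed.

Lemma csmooth_cderive f : csmooth f -> csmooth (cderive f).
Proof. by move=> [fr fi]; split; exact: smooth_derive1. Qed.

Lemma cderive_cst (c : K[i]) : cderive (fun=> c) = (fun=> 0).
Proof. by apply/funext => x; rewrite /cderive !derive1_cst. Qed.

Lemma periodic_cderive f T : periodic f T -> periodic (cderive f) T.
Proof.
by move=> fT x; congr (_ +i* _); apply: periodic_derive1 => y; rewrite fT.
Qed.

End ComplexSmooth.

(** * Smooth Grassmann-valued functions on the line and on the circle *)

Section CircleSmooth.
Variable K : realType.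
Implicit Types f g : K -> grassmann K[i].

Lemma gcoef_notin (C : comNzRingType) (a : grassmann C)
    (D : {fset {fset nat}}) S :
  (msupp a `<=` D)%fset -> S \notin D -> gcoef S a = 0.
Proof.
by move=> /fsubsetP aD SD; apply: gcoef_out; apply: contra SD; exact: aD.
Qed.

(** With its converse [gcoef_notin], this reduces the uniform support bound in [gsmooth] to the
    vanishing of coefficients. *)
Lemma msupp_sub (C : comNzRingType) (a : grassmann C) (D : {fset {fset nat}}) :
  (forall S, S \notin D -> gcoef S a = 0) -> (msupp a `<=` D)%fset.
Proof.
move=> a0; apply/fsubsetP => S; apply: contraLR => /a0 aS.
by rewrite -mcoeff_eq0; apply/eqP.
Qed.

Lemma gsmoothD f g : gsmooth f -> gsmooth g -> gsmooth (fun x => f x + g x).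
Proof.
move=> [[D fD] fS] [[E gE] gS]; split; last first.
  move=> S; under eq_fun do rewrite raddfD.
  exact: csmoothD (fS S) (gS S).
exists (D `|` E)%fset => x; apply: msupp_sub => S.
rewrite inE => /norP[SD SE]; rewrite raddfD /=.
rewrite (gcoef_notin _ _ _ _ (fD x) SD).
by rewrite (gcoef_notin _ _ _ _ (gE x) SE) addr0.
Qed.

Lemma gsmoothM f g : gsmooth f -> gsmooth g -> gsmooth (fun x => f x * g x).
Proof.
move=> [[D fD] fS] [[E gE] gS].
(* Summing over [D] and [E] instead of the supports makes the index ranges independent of [x]; the
   last factor is a structure constant. *)
have mulE U x : gcoef U (f x * g x) = \sum_(S <- D) \sum_(T <- E)
    gcoef S (f x) * gcoef T (g x) * gcoef U (gmul_mon S T).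
  rewrite [_ * _](gmulEw (fD x) (gE x)) raddf_sum /=; apply: eq_bigr => S _.
  by rewrite raddf_sum /=; apply: eq_bigr => T _; rewrite linearZ.
split; last first.
  move=> U; under eq_fun do rewrite mulE.
  do 2![apply: csmooth_sum => ?]; apply: csmoothM; last exact: csmooth_cst.
  exact: csmoothM.
(* A product of monomials a_S a_T is zero or, up to sign, the monomial of the union. *)
exists [fset (S `|` T)%fset | S in D, T in E]%fset => x.
apply: msupp_sub => U UDE.
rewrite mulE big_seq big1 // => S SD; rewrite big_seq big1 // => T TE.
rewrite /gmul_mon; case: ifP => _; last by rewrite linear0 mulr0.
rewrite linearZ /= gcoef_mon; case: eqP => [STU|_]; last by rewrite !mulr0.
by case/negP: UDE; rewrite -STU; apply/imfset2P; exists S => //; exists T.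
Qed.

Lemma gsmooth_gderive f : gsmooth f -> gsmooth (gderive f).
Proof.
move=> fS; have [[D fD] cS] := fS; split; last first.
  move=> S; under eq_fun do rewrite gcoef_gderive //.
  exact: csmooth_cderive (cS S).
(* A coefficient outside [D] vanishes identically in [x], hence so does its derivative. *)
exists D => x; apply: msupp_sub => S SD; rewrite gcoef_gderive //.
under eq_fun do rewrite (gcoef_notin _ _ _ _ (fD _) SD).
by rewrite cderive_cst.
Qed.

Lemma circle_smoothD f g :
  circle_smooth f -> circle_smooth g -> circle_smooth (fun x => f x + g x).
Proof.
by move=> [fS fp] [gS gp]; split=> [|x]; [exact: gsmoothD | rewrite fp gp].
Qed.

Lemma circle_smoothM f g :
  circle_smooth f -> circle_smooth g -> circle_smooth (fun x => f x * g x).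
Proof.
by move=> [fS fp] [gS gp]; split=> [|x]; [exact: gsmoothM | rewrite fp gp].
Qed.

Lemma circle_smooth_gderive f : circle_smooth f -> circle_smooth (gderive f).
Proof.
move=> [fS fp]; split; first exact: gsmooth_gderive.
move=> x; apply/gcoefP => S; rewrite !gcoef_gderive //.
by apply: periodic_cderive => y; rewrite fp.
Qed.

End CircleSmooth.

(** * Coordinates of the two forms, and the contact condition *)

Lemma scale_contact_form (K : realType) (h : with_theta (grassmann K[i])) :
  h *: contact_form K = (h, (0, h.1)).
Proof.
(* The [dtheta] coefficient is h theta, where theta^2 = 0 removes the odd-coordinate part of h. *)
case: h => a b; congr (_, _); congr (_, _);
by rewrite /= !(mulr0, mul0r, mulr1, mul1r, addr0, add0r).
Qed.

(** The outer pair lists the [dphi] and [dtheta] coefficients, each inner pair the parts of degree 0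
    and 1 in theta. *)
Lemma pull_contact_form (K : realType) (Q q R r : K -> grassmann K[i]) x :
  pull_form Q q R r (contact_form K) x =
  ((gderive Q x + r x * gderive r x,
    gderive q x + (r x * gderive R x + R x * gderive r x)),
   (q x + r x * R x, R x * R x)).
Proof.
congr (_, _); congr (_, _);
by rewrite /= !(mulr0, mul0r, mulr1, mul1r, addr0, add0r).
Qed.

Theorem proposition3p3 (K : realType) (Q q R r : K -> grassmann K[i])
    (hg : superdiffeo Q q R r) :
  contact Q q R r <->
  (forall x : K, R x ^+ 2 = gderive Q x + r x * gderive r x) /\
  (forall x : K, q x + r x * R x = 0).
Proof.
split=> [[h [_ hE]]|[eR eq]].
  split=> x; move: (hE x); rewrite pull_contact_form scale_contact_form => e.
    (* Both Q' + r r' and R^2 equal the theta-free part of [h x], which is then eliminated. *)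
    have e1 := congr1 (fun w : form1 _ => w.1.1) e.
    have e2 := congr1 (fun w : form1 _ => w.2.2) e.
    by rewrite expr2 [RHS]e1; exact: e2.
  by have e1 := congr1 (fun w : form1 _ => w.2.1) e; exact: e1.
have [_ _ RS qS rS _ _ _ _ _ _ _ _] := hg.
(* The second entry is copied from the theta part of the [dphi] coefficient, so that part matches
   automatically. *)
exists (fun x => (R x * R x,
  gderive q x + (r x * gderive R x + R x * gderive r x))); split.
  split=> /=; first exact: circle_smoothM.
  by apply: circle_smoothD; [|apply: circle_smoothD; apply: circle_smoothM];
    try exact: circle_smooth_gderive.
move=> x; rewrite pull_contact_form scale_contact_form /=.
by rewrite -eR eq expr2.
Qed.
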